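(* Let $M$ be a finite connected matroid of positive rank on the set $E$, and let $K$ be an arbitrary field. Then the multivariate Tutte polynomial $\hat Z_M(q,\mathbf{v})$, regarded as a polynomial in $q$, is irreducible over $K(\mathbf{v})$.
   Context: Let $M$ be a finite matroid on the ground set $E$ with rank function $r_M$; its rank is $r(M)=r_M(E)$. A matroid is connected if any two distinct elements of its ground set lie in a common circuit (equivalently, it is not a direct sum of two matroids on non-empty ground sets). For each $e\in E$ let $v_e$ be a variable, with all these variables algebraically independent over $K$, and let $\mathbf{v}=\{v_e\}_{e\in E}$. With a further variable $q$, the multivariate Tutte polynomial of $M$ is $$\hat Z_M(q,\mathbf{v})=\sum_{A\subseteq E}q^{\,r(M)-r_M(A)}\prod_{e\in A}v_e,$$ with integer coefficients interpreted in $K$. *)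

(* Defs.v *)
From mathcomp Require Import all_boot all_order all_algebra.
From mathcomp Require Import mpoly.

Set Implicit Arguments.
Unset Strict Implicit.
Unset Printing Implicit Defensive.

Import GRing.Theory.
Local Open Scope ring_scope.

(* The ground set is the whole of the finite type E. *)
Record matroid (E : finType) := Matroid {
  indep : {set E} -> bool;
  indep_set0 : indep set0;
  indep_subset : forall I J : {set E}, I \subset J -> indep J -> indep I;
  indep_augment : forall I J : {set E}, indep I -> indep J ->
    (#|I| < #|J|)%N -> exists2 e : E, e \in J :\: I & indep (e |: I)
}.

Definition mrank (E : finType) (M : matroid E) (A : {set E}) : nat :=
  \max_(I : {set E} | (I \subset A) && indep M I) #|I|.

Definition circuit (E : finType) (M : matroid E) (C : {set E}) : bool :=
  minset (fun A : {set E} => ~~ indep M A) C.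

Definition mconnected (E : finType) (M : matroid E) : Prop :=
  forall e f : E, e != f ->
    exists C : {set E}, [/\ circuit M C, e \in C & f \in C].

(* A polynomial in q = 'X.  The natural-number subtraction in the exponent is
   never truncated, since mrank M is monotone. *)
Definition multivariate_tutte (R : comNzRingType) (E : finType) (M : matroid E)
    (v : E -> R) : {poly R} :=
  \sum_(A : {set E})
    (\prod_(e in A) v e)%:P * 'X^(mrank M [set: E] - mrank M A)%N.

(* K(v) for the family v of independent variables indexed by E. *)
Definition ratfun (K : fieldType) (E : finType) : fieldType :=
  {fraction {mpoly K[#|E|]}}.

Definition ratvar (K : fieldType) (E : finType) (e : E) : ratfun K E :=
  tofrac ('X_(enum_rank e) : {mpoly K[#|E|]}).
Arguments ratvar K {E} e.

(* Main.v *)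
Require Import Defs.
From HB Require Import structures.
From mathcomp Require Import all_boot all_order all_algebra ring zify.
From mathcomp Require Import mpoly.

(** Write Z for the multivariate Tutte polynomial, r for the rank of M and
    R = K[v].

    A connected matroid of positive rank has no loops, so the only subset of
    rank zero is the empty one and Z, as a polynomial in q, is monic of degree
    r with coefficients in R.  Because R is integrally closed, every monic
    factor of Z over K(v) already has its coefficients in R
    ([monic_divisor_integral]).  It is therefore enough to show that in a
    factorisation Z = f g with f and g monic over R one factor is constant
    ([tutte_factor_trivial]).

    Integral closedness is used in the complete form: a fraction all of whose
    powers have a common denominator lies in R.  For polynomial rings this
    follows by comparing leading monomials
    ([mpoly_completely_integrally_closed]).  If f is a monic factor of Z and A
    its companion matrix, then Z(A) = 0 bounds the denominators of all powers
    of A, hence those of all powers of f = det(q - A), and this forces the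
    coefficients of f into R.

    In Z = f g each variable v_e occurs with degree at most one on the left,
    so it is missing from f or from g ([isolate_split]).  Split E accordingly
    into S, whose variables are missing from f, and its complement, whose
    variables are missing from g.  For a subset A, write Z(A) for the value of
    Z at v_e = 1 for e in A and v_e = 0 elsewhere.  For every subset C

        Z(C :&: S) Z(C :\: S) = f(0) g(C) f(C) g(0) = Z(C) Z(set0).

    If both parts of E are non-empty, some circuit C meets both.  Its two
    pieces are independent, all values are explicit ([tutte_indep],
    [tutte_circuit]), and the identity would give q = 1, which is absurd.
    Otherwise one factor involves no variable at all.  It then divides
    Z(set0) = q^r as well as Z(I) = (1 + q)^r for a basis I, and these are
    coprime, so it is constant ([free_factor_trivial]). *)

Set Implicit Arguments.
Unset Strict Implicit.
Unset Printing Implicit Defensive.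
Import Order.TTheory GRing.Theory.
Local Open Scope ring_scope.

(** * Monic factors over the fraction field *)

Local Notation "x %:F" := (tofrac x).

Definition completely_integrally_closed (R : idomainType) :=
  forall (x : {fraction R}) (d : R), d != 0 ->
    (forall n, exists p, d%:F * x ^+ n = p%:F) -> exists y, x = y%:F.

(** The same denominator d serves for x and for its translates by elements of
    the base ring.  Stated for an arbitrary morphism because it is applied both
    to fractions and to polynomials with fraction coefficients. *)
Lemma almost_integral_shift (R S : comNzRingType) (iota : {rmorphism R -> S})
    (x d : S) (y : R) :
    (forall n, exists p, d * x ^+ n = iota p) ->
  forall n, exists p, d * (x - iota y) ^+ n = iota p.
Proof.
move=> x_int n.
(* Carrying an extra power of x along makes the induction on n go through
   without the binomial formula. *)
suff: forall j, exists p, d * ((x - iota y) ^+ n * x ^+ j) = iota p.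
  by case/(_ 0%N) => p; rewrite expr0 mulr1; exists p.
elim: n => [|n IHn] j; first by rewrite expr0 mul1r.
have [[p0 E0] [p1 E1]] := (IHn j, IHn j.+1).
exists (p1 - y * p0); rewrite rmorphB rmorphM -E0 -E1.
by rewrite !exprS; ring.
Qed.

Lemma fraction_denom (R : idomainType) (x : {fraction R}) :
  exists2 d : R, d != 0 & exists a, d%:F * x = a%:F.
Proof.
elim/quotW: x => y.
exists (\d_y); first exact: denom_ratioP.
exists (\n_y).
unlock tofrac; rewrite -[LHS]FracField.pi_mul.
apply/eqmodP; rewrite /= FracField.equivfE.
rewrite /FracField.mulf !numden_Ratio ?mul1r ?mulr1 ?oner_eq0 //;
  by rewrite denom_ratioP.
Qed.

(** Let x = a / b.  Divisibility of d a^n by b^n for all n forces the leading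
    monomial of b to divide that of a.  Subtracting the quotient t of the
    leading terms keeps x almost integral and lowers the leading monomial of
    the numerator, so the induction ends with x equal to a sum of such t. *)
Lemma mpoly_completely_integrally_closed (K : fieldType) (n : nat) :
  completely_integrally_closed {mpoly K[n]}.
Proof.
move=> x d dN0; have [b bN0 [a]] := fraction_denom x.
elim/mleadrect: a x => a IHa x bx_a x_int.
have [a0|aN0] := eqVneq a 0.
  exists 0; move/eqP: bx_a.
  by rewrite a0 rmorph0 mulf_eq0 tofrac_eq0 (negPf bN0) => /eqP.
have le_ba : (mlead b <= mlead a)%MM.
  apply/mnm_lepP => i; rewrite leqNgt; apply/negP => lt_ab.
  (* An exponent so large that d cannot make up for the missing powers of
     the i-th variable. *)
  pose N := (mlead d i).+1.
  have [c Ec] := x_int N.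
  have {}Ec : d * a ^+ N = c * b ^+ N.
    apply/eqP; rewrite -tofrac_eq !rmorphM !rmorphXn /= -Ec -bx_a exprMn.
    by rewrite mulrA mulrAC.
  have cN0 : c != 0.
    apply: contra_eq_neq Ec => ->.
    by rewrite mul0r mulf_neq0 // expf_neq0.
  have /(congr1 (fun p : {mpoly K[n]} => mlead p i)) := Ec.
  rewrite !mleadM ?expf_neq0 // !mleadX // !mnmDE !mulmnE => /eqP.
  apply/negP; rewrite neq_ltn; apply/orP; left.
  apply: (leq_trans _ (leq_addl _ _)).
  apply: (leq_trans _ (leq_mul lt_ab (leqnn N))).
  by rewrite mulSn ltn_add2r ltnS.
pose t : {mpoly K[n]} := (mleadc a / mleadc b) *: 'X_[mlead a - mlead b].
have lcb : mleadc b != 0 by rewrite mleadc_eq0.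
have lca : mleadc a != 0 by rewrite mleadc_eq0.
have tcN0 : mleadc a / mleadc b != 0 by rewrite mulf_neq0 ?invr_eq0.
have tN0 : t != 0 by rewrite -mleadc_eq0 mleadcZE mleadXm mcoeffX eqxx mulr1.
have lead_t : mlead t = (mlead a - mlead b)%MM by rewrite mleadZ // mleadXm.
have lead_tb : mlead (t * b) = mlead a by rewrite mleadM // lead_t submK.
have [Ea|rN0] := eqVneq (a - t * b) 0.
  exists t; apply: (@mulfI _ b%:F); first by rewrite tofrac_eq0.
  by rewrite bx_a -rmorphM mulrC; congr _%:F; apply/eqP; rewrite -subr_eq0 Ea.
have lt_r : (mlead (a - t * b) < mlead a)%O.
  rewrite lt_neqAle; apply/andP; split; last first.
    by apply: le_trans (mleadB_le _ _) _; rewrite lead_tb leUx lexx.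
  apply: contraNneq rN0 => E; rewrite -mleadc_eq0 E mcoeffB.
  rewrite -{2}lead_tb mleadM // mleadcM mleadcZE mleadXm.
  by rewrite mcoeffX eqxx mulr1 divfK // subrr.
have [|y Ey] := IHa _ lt_r (x - t%:F) _ (almost_integral_shift t x_int).
  by rewrite mulrBr bx_a -rmorphM -rmorphB mulrC.
by exists (y + t); rewrite rmorphD /= -Ey subrK.
Qed.

Lemma common_denom (R : idomainType) (I : finType) (x : I -> {fraction R}) :
  exists2 d : R, d != 0 & exists a : I -> R, forall i, d%:F * x i = (a i)%:F.
Proof.
have /fin_all_exists2[d dN0 /fin_all_exists[a da]] :
  forall i, exists2 d : R, d != 0 & exists a, d%:F * x i = a%:F.
  by move=> i; exact: fraction_denom.
exists (\prod_i d i); first by apply/prodf_neq0 => i _; exact: dN0.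
exists (fun i => (\prod_(j | j != i) d j) * a i) => i.
by rewrite (bigD1 i) //= mulrC rmorphM mulrCA mulrA da -rmorphM mulrC.
Qed.

(** Reducing the monomial of degree j modulo the monic polynomial z rewrites
    the j-th power of A as a combination, with coefficients in R, of the
    finitely many powers below the degree of z; a common denominator of those
    serves for all of them. *)
Lemma powers_common_denom (R : idomainType) (n : nat)
    (A : 'M[{fraction R}]_n.+1) (z : {poly R}) :
    z \is monic -> horner_mx A (map_poly (@tofrac R) z) = 0 ->
  exists2 d : R, d != 0 &
    forall j, exists N : 'M[R]_n.+1, d%:F *: A ^+ j = map_mx (@tofrac R) N.
Proof.
move=> z_monic zA0; pose r := (size z).-1.
have [d dN0 [a Ea]] := common_denom
  (fun t : 'I_r * 'I_n.+1 * 'I_n.+1 => (A ^+ t.1.1) t.1.2 t.2).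
exists d => // j; pose p := Pdiv.Ring.rmodp 'X^j z.
have sz_p : (size p <= r)%N.
  rewrite -ltnS prednK ?size_poly_gt0 ?monic_neq0 //.
  by rewrite Pdiv.Ring.ltn_rmodpN0 ?monic_neq0.
exists (\sum_(i < r) p`_i *: \matrix_(k, l) a (i, k, l)).
have -> : A ^+ j = horner_mx A (map_poly (@tofrac R) p).
  transitivity (horner_mx A (map_poly (@tofrac R) 'X^j)).
    by rewrite map_polyXn rmorphXn /= horner_mx_X.
  rewrite {1}(Pdiv.RingMonic.rdivp_eq z_monic 'X^j) !rmorphD !rmorphM /=.
  by rewrite zA0 mulr0 add0r.
have sz_pA : (size (map_poly scalar_mx (map_poly (@tofrac R) p)
                : {poly 'M[{fraction R}]_n.+1}) <= r)%N.
  by do 2!apply: leq_trans (size_poly _ _) _.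
rewrite /horner_mx /= /horner_morph (horner_coef_wide _ sz_pA).
apply/matrixP => k l; rewrite !mxE !summxE rmorph_sum mulr_sumr /=.
apply: eq_bigr => i _; rewrite !coef_map /= -mulmxE mul_scalar_mx !mxE.
by rewrite rmorphM /= -(Ea (i, k, l)) mulrCA.
Qed.

(** With A the companion matrix of f, one has f = det(q - A).  The powers of A
    share a denominator d, hence so do the powers of q - A, and taking
    determinants shows that the powers of f do too. *)
Lemma monic_divisor_powers (R : idomainType) (f : {poly {fraction R}})
    (z : {poly R}) :
    f \is monic -> z \is monic -> f %| map_poly (@tofrac R) z ->
  exists2 d : R, d != 0 &
    forall n, exists p, d%:F *: f ^+ n = map_poly (@tofrac R) p.
Proof.
move=> f_monic z_monic f_dvd.
(* Matrices of size zero do not form a nontrivial ring; they correspond to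
   f = 1. *)
have : (exists n (A : 'M[{fraction R}]_n.+1), char_poly A = f) \/ f = 1.
  move: (companionmx f) (companionmxK f_monic).
  case: (size f).-1 => [|n] A charA; last by left; exists n, A.
  by right; rewrite -charA /char_poly det_mx00.
case=> [[n [A charA]]|f1]; last first.
  exists 1; first exact: oner_neq0.
  by move=> n; exists 1; rewrite f1 expr1n rmorph1 scale1r rmorph1.
have zA0 : horner_mx A (map_poly (@tofrac R) z) = 0.
  case/dvdpP: f_dvd => g ->.
  by rewrite rmorphM /= -charA Cayley_Hamilton mulr0.
have [d dN0 dA] := powers_common_denom z_monic zA0.
(* The factor A ^+ j is there for the induction on k, which turns one factor
   q - A into q times an instance at j minus an instance at j + 1. *)
pose lift := map_mx (map_poly (@tofrac R)) : 'M[{poly R}]_n.+1 -> _.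
have clear k j : exists N : 'M[{poly R}]_n.+1,
    d%:F%:P *: (char_poly_mx A ^+ k * map_mx polyC (A ^+ j)) = lift N.
  elim: k j => [|k IHk] j.
    have [N EN] := dA j; exists (map_mx polyC N).
    rewrite expr0 mul1r; apply/matrixP => a b; move/matrixP: EN => /(_ a b).
    by rewrite !mxE map_polyC /= => <-; rewrite rmorphM.
  have [N0 E0] := IHk j; have [N1 E1] := IHk j.+1.
  exists ('X *: N0 - N1).
  rewrite /lift map_mxB map_mxZ /= map_polyX -/(lift N0) -/(lift N1) -E0 -E1.
  rewrite scalerA mulrC -scalerA -scalerBr; congr (_ *: _).
  rewrite exprSr -mulrA /char_poly_mx mulrBl mulrBr; congr (_ - _).
    by rewrite -mulmxE mul_scalar_mx -scalemxAr.
  by rewrite -rmorphM /= -exprS.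
exists (d ^+ n.+1); first exact: expf_neq0.
move=> k; have [N /(congr1 determinant)] := clear k 0%N.
rewrite expr0 map_mx1 mulr1 detZ det_map_mx /= => E.
exists (\det N); rewrite -{}E.
rewrite -mul_polyC rmorphXn rmorphXn /=; congr (_ * _).
rewrite -charA /char_poly.
by elim: k => [|k IHk]; rewrite ?expr0 ?det1 // !exprS IHk -detM.
Qed.

(** The leading coefficient of f is almost integral over R because its powers
    are the leading coefficients of the powers of f; remove the leading term
    and repeat. *)
Lemma almost_integral_poly (R : idomainType) (f : {poly {fraction R}}) (d : R) :
    completely_integrally_closed R -> d != 0 ->
    (forall n, exists p, d%:F *: f ^+ n = map_poly (@tofrac R) p) ->
  exists f0, f = map_poly (@tofrac R) f0.
Proof.
move=> R_cic dN0; have [k] := ubnP (size f).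
elim: k f => // k IHk f sz_f f_int.
have [->|fN0] := eqVneq f 0; first by exists 0; rewrite rmorph0.
have [n|y Ey] := R_cic (lead_coef f) d dN0.
  have [p /(congr1 (fun q : {poly _} => q`_(size (f ^+ n)).-1))] := f_int n.
  rewrite coefZ -/(lead_coef _) lead_coef_exp coef_map /= => ->.
  by eexists.
pose t := y *: 'X^((size f).-1).
have [|n|g Eg] := IHk (f - map_poly (@tofrac R) t).
- rewrite -ltnS; apply: leq_trans sz_f.
  rewrite map_polyZ map_polyXn /= -Ey ltnS (polySpred fN0) ltnS.
  apply/leq_sizeP => j le_j; rewrite coefB coefZ coefXn.
  have [<-|ne_j] := eqVneq (size f).-1 j; first by rewrite mulr1 subrr.
  rewrite mulr0 subr0 nth_default // polySpred //.
  by rewrite ltn_neqAle ne_j.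
- have f_int' j : exists p, d%:F%:P * f ^+ j = map_poly (@tofrac R) p.
    by rewrite mul_polyC.
  have [p Ep] := almost_integral_shift t f_int' n.
  by exists p; rewrite -Ep mul_polyC.
by exists (g + t); rewrite rmorphD /= -Eg subrK.
Qed.

Lemma monic_divisor_integral (R : idomainType) (f : {poly {fraction R}})
    (z : {poly R}) :
    completely_integrally_closed R ->
    f \is monic -> z \is monic -> f %| map_poly (@tofrac R) z ->
  exists f0, f = map_poly (@tofrac R) f0.
Proof.
move=> R_cic f_monic z_monic f_dvd.
have [d dN0 f_int] := monic_divisor_powers f_monic z_monic f_dvd.
exact: almost_integral_poly R_cic dN0 f_int.
Qed.

(** After scaling, a divisor and its cofactor are both monic, so both have
    their coefficients in R and give a factorisation over R. *)
Lemma irreducible_over_fraction (R : idomainType) (z : {poly R}) :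
    completely_integrally_closed R -> z \is monic -> (1 < size z)%N ->
    (forall f g, f \is monic -> g \is monic -> f * g = z ->
      size f = 1%N \/ size g = 1%N) ->
  irreducible_poly (map_poly (@tofrac R) z).
Proof.
move=> R_cic z_monic z_gt1 z_irr.
have tofrac_inj : injective (@tofrac R).
  by move=> x y /eqP; rewrite tofrac_eq => /eqP.
have zF_monic : map_poly (@tofrac R) z \is monic by exact: monic_map.
split=> [|p sz_p p_dvd].
  by rewrite size_map_inj_poly.
have pN0 : p != 0 by apply: contraTneq p_dvd => ->; rewrite dvd0p monic_neq0.
have [f [f_monic f_eqp]] : exists f, f \is monic /\ f %= p.
  exists ((lead_coef p)^-1 *: p).
  by rewrite monicE lead_coefZ mulVf ?eqp_scale ?invr_eq0 ?lead_coef_eq0.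
have f_dvd : f %| map_poly (@tofrac R) z by rewrite (eqp_dvdl _ f_eqp).
have /dvdpP[g Eg] := f_dvd.
have g_monic : g \is monic by rewrite -(monicMr _ f_monic) -Eg.
have g_dvd : g %| map_poly (@tofrac R) z by rewrite Eg dvdp_mulr.
have [f0 Ef] := monic_divisor_integral R_cic f_monic z_monic f_dvd.
have [g0 Eg0] := monic_divisor_integral R_cic g_monic z_monic g_dvd.
have lift_monic p0 : map_poly (@tofrac R) p0 \is monic -> p0 \is monic.
  rewrite !monicE lead_coef_map_inj ?rmorph0 // => /eqP lead1.
  by apply/eqP/tofrac_inj; rewrite lead1 rmorph1.
have f0_monic : f0 \is monic by apply: lift_monic; rewrite -Ef.
have g0_monic : g0 \is monic by apply: lift_monic; rewrite -Eg0.
have E0 : f0 * g0 = z.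
  apply: (map_inj_poly tofrac_inj (rmorph0 _)).
  by rewrite rmorphM /= -Ef -Eg0 Eg mulrC.
have [f1|g1] := z_irr _ _ f0_monic g0_monic E0.
  by case/eqP: sz_p; rewrite -(eqp_size f_eqp) Ef size_map_inj_poly // rmorph0.
have {}g1 : size g = 1%N by rewrite Eg0 size_map_inj_poly // rmorph0.
rewrite eqp_sym; apply: eqp_trans f_eqp; rewrite Eg.
rewrite (size1_polyC (eq_leq g1)) mul_polyC eqp_scale //.
by rewrite -polyC_eq0 -(size1_polyC (eq_leq g1)) monic_neq0.
Qed.

(** * Values of the Tutte polynomial on independent sets and circuits *)

Section Matroid.
Variables (E : finType) (M : matroid E).
Implicit Types A B C I : {set E}.
Local Notation rk := (mrank M [set: E]).

Lemma mrank_indep I : indep M I -> mrank M I = #|I|.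
Proof.
move=> iI; apply/eqP; rewrite eqn_leq; apply/andP; split.
  by apply/bigmax_leqP => J /andP[/subset_leq_card].
by rewrite /mrank (leq_bigmax_cond (F := fun J : {set E} => #|J|)) ?subxx.
Qed.

Lemma card_indep_le A I : I \subset A -> indep M I -> (#|I| <= mrank M A)%N.
Proof.
move=> sIA iI.
by rewrite /mrank (leq_bigmax_cond (F := fun J : {set E} => #|J|)) ?sIA.
Qed.

Lemma mrank_base A : exists2 I : {set E}, indep M I & #|I| = mrank M A.
Proof.
have P0 : (set0 \subset A) && indep M set0 by rewrite sub0set indep_set0.
rewrite /mrank (bigop.bigmax_eq_arg (F := fun I : {set E} => #|I|) set0 P0).
by case: arg_maxnP => // I /andP[_ iI] _; exists I.
Qed.

Lemma circuit_proper_indep C A : circuit M C -> A \proper C -> indep M A.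
Proof.
move=> /minsetP[_ minC] pAC; apply/negPn/negP => dA.
by move: (pAC); rewrite (minC A dA (proper_sub pAC)) properxx.
Qed.

Lemma mrank_circuit C : circuit M C -> (mrank M C).+1 = #|C|.
Proof.
move=> cC; have dC : ~~ indep M C by case/minsetP: cC.
have [C0|[x xC]] := set_0Vmem C; first by rewrite C0 indep_set0 in dC.
have C_gt0 : (0 < #|C|)%N by rewrite card_gt0; apply/set0Pn; exists x.
apply/eqP; rewrite eqn_leq; apply/andP; split.
  rewrite -(prednK C_gt0) ltnS; apply/bigmax_leqP => I /andP[sIC iI].
  rewrite -ltnS (prednK C_gt0).
  apply: proper_card; rewrite properEneq sIC andbT.
  by apply: contraNneq dC => <-.
rewrite (cardsD1 x) xC ltnS; apply: card_indep_le; first exact: subsetDl.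
by apply: circuit_proper_indep cC _; rewrite properD1.
Qed.

(** A loop is a circuit by itself, so no circuit joins it to another element;
    and if it is the only element of E then M has rank zero. *)
Lemma connected_loopless e : mconnected M -> (0 < rk)%N -> indep M [set e].
Proof.
move=> conn rk_gt0.
have [/existsP[f fe]|/existsPn no_f] := boolP [exists f, f != e].
  have [C [cC fC eC]] := conn f e fe.
  apply: circuit_proper_indep cC _; apply/properP.
  split; first by rewrite sub1set.
  by exists f => //; rewrite inE.
move: rk_gt0; rewrite /mrank lt0n => /eqP rk0; apply/negPn/negP => de.
apply/rk0/eqP; rewrite -leqn0; apply/bigmax_leqP => I /andP[_ iI].
rewrite leqn0 cards_eq0; apply: contraNT de => /set0Pn[x xI].
apply: indep_subset iI; rewrite sub1set.
by have := no_f x; rewrite negbK => /eqP <-.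
Qed.

Lemma mrank_gt0 A :
  (forall e, indep M [set e]) -> A != set0 -> (0 < mrank M A)%N.
Proof.
move=> loopless /set0Pn[e eA].
by have := card_indep_le (A := A) _ (loopless e); rewrite cards1 sub1set; apply.
Qed.

(** The only contribution to the power of q of exponent the rank of M comes
    from the empty set, every other set having positive rank. *)
Lemma tutte_monic (R : comNzRingType) (v : E -> R) :
    (forall e, indep M [set e]) -> (0 < rk)%N ->
  multivariate_tutte M v \is monic /\
  size (multivariate_tutte M v) = rk.+1.
Proof.
move=> loopless rk_gt0; rewrite /multivariate_tutte (bigD1 set0) //=.
rewrite big_set0 mul1r (mrank_indep (indep_set0 M)) cards0 subn0.
set S := (X in 'X^_ + X).
have sz_S : (size S < size ('X^rk : {poly R}))%N.
  rewrite size_polyXn ltnS; apply: leq_trans (size_sum _ _ _) _.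
  apply/bigmax_leqP => A A0; rewrite mul_polyC.
  apply: leq_trans (size_scale_leq _ _) _; rewrite size_polyXn.
  by have := mrank_gt0 loopless A0; lia.
by rewrite monicE lead_coefDl // lead_coefXn size_polyDl // size_polyXn.
Qed.

Section Indicator.
Variable K : fieldType.

Definition indicator A (e : E) : K := (e \in A)%:R.

Lemma tutte_indicator A :
  multivariate_tutte M (indicator A) =
  \sum_(B : {set E} | B \subset A) 'X^(rk - mrank M B).
Proof.
rewrite [RHS]big_mkcond; apply: eq_bigr => B _.
case: ifPn => [sBA|/subsetPn[x xB xA]].
  rewrite big1 ?mul1r // => e eB.
  by rewrite /indicator (subsetP sBA).
by rewrite (bigD1 x) //= /indicator (negPf xA) !mul0r.
Qed.

Lemma sum_subset_Xn N A : (#|A| <= N)%N ->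
  \sum_(B : {set E} | B \subset A) 'X^(N - #|B|) =
  'X^(N - #|A|) * (1 + 'X) ^+ #|A| :> {poly K}.
Proof.
move=> leAN.
(* For i outside A the first summand vanishes, so that only the subsets of A
   survive when the product is expanded. *)
have -> : (1 + 'X) ^+ #|A| = \prod_(i : E)
  ((i \in A)%:R + (if i \in A then 'X else 1)) :> {poly K}.
  rewrite -prodr_const big_mkcond; apply: eq_bigr => i _.
  by case: (i \in A); rewrite ?add0r.
rewrite bigA_distr big_distrr /= big_mkcond; apply: eq_bigr => B _.
case: ifPn => [sBA|/subsetPn[x xB xA]]; last first.
  by rewrite (bigD1 x) //= xB (negPf xA) mul0r mulr0.
transitivity ('X^(N - #|A|) * 'X^(#|A :\: B|) : {poly K}).
  rewrite -exprD; congr 'X^_.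
  have := cardsID B A; rewrite (setIidPr sBA).
  by have := subset_leq_card sBA; lia.
congr (_ * _); rewrite -prodr_const big_mkcond; apply: eq_bigr => i _.
rewrite inE; case: ifPn => [/andP[/negPf -> ->] //|].
have [iB|] := boolP (i \in B); first by rewrite (subsetP sBA).
by rewrite /= => _ /negPf ->.
Qed.

Lemma tutte_indep I : indep M I ->
  multivariate_tutte M (indicator I) = 'X^(rk - #|I|) * (1 + 'X) ^+ #|I|.
Proof.
move=> iI; rewrite tutte_indicator -sum_subset_Xn; last first.
  exact: card_indep_le (subsetT _) iI.
apply: eq_bigr => B sBI; congr 'X^(_ - _).
exact: mrank_indep (indep_subset sBI iI).
Qed.

(** Only C itself differs from the independent case, having rank one less than
    its size.  The extra factor q on the left keeps the exponents on the right
    non-negative: C can have one more element than the rank of M. *)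
Lemma tutte_circuit C : circuit M C ->
  'X * multivariate_tutte M (indicator C) =
  'X^(rk.+1 - #|C|) * ((1 + 'X) ^+ #|C| + 'X - 1).
Proof.
move=> cC; have rC := mrank_circuit cC.
have le_C : (#|C| <= rk.+1)%N.
  rewrite -rC ltnS; apply/bigmax_leqP => I /andP[_ iI].
  exact: card_indep_le (subsetT _) iI.
rewrite -addrA mulrDr -sum_subset_Xn // tutte_indicator.
rewrite (bigD1 C) //= [in RHS](bigD1 C) //= mulrDr -exprS.
rewrite [X in _ + X = _](_ : _ =
  \sum_(B : {set E} | (B \subset C) && (B != C)) 'X^(rk.+1 - #|B|)).
  have -> : (rk - mrank M C).+1 = (rk.+1 - #|C|).+1 by lia.
  rewrite (exprS _ (rk.+1 - #|C|)%N).
  move: (\sum_(B | _) _) ('X^(rk.+1 - #|C|)) => s x; ring.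
rewrite mulr_sumr; apply: eq_bigr => B; rewrite andbC -properEneq => pBC.
have iB := circuit_proper_indep cC pBC.
have := card_indep_le (subsetT _) iB.
by rewrite -exprS (mrank_indep iB) => ?; congr 'X^_; lia.
Qed.

End Indicator.
End Matroid.

(** * Specialising and isolating variables *)

Lemma mpoly_rmorph_ext (K R : comNzRingType) (n : nat)
    (f g : {rmorphism {mpoly K[n]} -> R}) :
  (forall c, f c%:MP = g c%:MP) -> (forall i, f 'X_i = g 'X_i) -> f =1 g.
Proof.
move=> fgC fgX p; rewrite (mpolyE p) !rmorph_sum /=; apply: eq_bigr => m _.
rewrite -mul_mpolyC !rmorphM /= fgC; congr (_ * _).
rewrite mpolyXE_id !rmorph_prod /=; apply: eq_bigr => i _.
by rewrite !rmorphXn /= fgX.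
Qed.

Lemma map_tutte (R S : comNzRingType) (E : finType) (M : matroid E)
    (f : {rmorphism R -> S}) (v : E -> R) :
  map_poly f (multivariate_tutte M v) = multivariate_tutte M (f \o v).
Proof.
rewrite /multivariate_tutte rmorph_sum; apply: eq_bigr => A _ /=.
by rewrite rmorphM /= map_polyC map_polyXn /= rmorph_prod.
Qed.

Lemma eq_tutte (R : comNzRingType) (E : finType) (M : matroid E)
    (v w : E -> R) : v =1 w -> multivariate_tutte M v = multivariate_tutte M w.
Proof.
move=> vw; apply: eq_bigr => A _.
by congr (_%:P * _); apply: eq_bigr => e _; rewrite vw.
Qed.

Section Variables.
Variables (K : fieldType) (E : finType).
Local Notation R := {mpoly K[#|E|]}.

Definition genvar (e : E) : R := 'X_(enum_rank e).

Definition spec (h : E -> K) : {poly R} -> {poly K} :=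
  map_poly (meval (fun i => h (enum_val i))).

HB.instance Definition _ h := GRing.RMorphism.copy (spec h)
  (map_poly (meval (fun i => h (enum_val i)))).

Lemma spec_tutte M h :
  spec h (multivariate_tutte M genvar) = multivariate_tutte M h.
Proof.
rewrite /spec map_tutte; apply: eq_tutte => e /=.
by rewrite mevalXU enum_rankK.
Qed.

(** On coefficients, [isolate] keeps every variable except v_e, which becomes
    the new outer variable. *)
Definition isolate_coef (e : E) : R -> {poly {poly R}} :=
  mmap (polyC \o polyC \o @mpolyC #|E| K)
    (fun i => if i == enum_rank e then 'X else ('X_i)%:P%:P).

HB.instance Definition _ e := GRing.RMorphism.copy (isolate_coef e)
  (mmap (polyC \o polyC \o @mpolyC #|E| K)
    (fun i => if i == enum_rank e then 'X else ('X_i)%:P%:P)).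

(** R[q] seen inside (R[q])[t] with v_e renamed t, so that the degree in v_e
    becomes the degree in the outer variable t and q becomes a coefficient. *)
Definition isolate (e : E) (p : {poly R}) : {poly {poly R}} :=
  (map_poly (isolate_coef e) p).['X%:P].

Lemma isolate_coef_genvar e x :
  isolate_coef e (genvar x) = if x == e then 'X else (genvar x)%:P%:P.
Proof.
rewrite /isolate_coef /genvar mmapX mmap1U.
by rewrite (inj_eq enum_rank_inj).
Qed.

Lemma isolateM e p q : isolate e (p * q) = isolate e p * isolate e q.
Proof. by rewrite /isolate rmorphM hornerM. Qed.

(** With v_e replaced by t, only the values of h at the other variables enter.
    Letting h differ from h' at e is what shows that a polynomial constant in t
    does not depend on v_e. *)
Lemma spec_isolate e (h h' : E -> K) p :
    (forall x, x != e -> h x = h' x) ->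
  (map_poly (spec h) (isolate e p)).[(h' e)%:P] = spec h' p.
Proof.
move=> hh'; pose rho : {rmorphism {poly {poly R}} -> {poly K}} :=
    horner_eval (h' e)%:P \o map_poly (spec h).
have -> : (map_poly (spec h) (isolate e p)).[(h' e)%:P] = rho (isolate e p).
  by [].
rewrite /isolate -[LHS](horner_map rho) -map_poly_comp.
have -> : rho 'X%:P = 'X.
  by rewrite /rho /= map_polyC /= /spec map_polyX /horner_eval hornerC.
have -> : map_poly (rho \o isolate_coef e) p = map_poly polyC (spec h' p).
  rewrite /spec -map_poly_comp; apply: eq_map_poly.
  apply: mpoly_rmorph_ext => [c|i] /=.
    rewrite mevalC /isolate_coef mmapC /= /rho /= map_polyC /=.
    by rewrite /spec map_polyC /= mevalC /horner_eval hornerC.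
  have -> : 'X_i = genvar (enum_val i) by rewrite /genvar enum_valK.
  rewrite isolate_coef_genvar /genvar mevalXU enum_rankK.
  move: (enum_val i) => x.
  case: eqVneq => [->|ne].
    by rewrite /rho /= map_polyX /horner_eval hornerX.
  rewrite /rho /= map_polyC /= /spec map_polyC /= mevalXU enum_rankK.
  by rewrite /horner_eval hornerC hh'.
exact: comp_polyXr.
Qed.

Lemma size_isolate_tutte e M :
  (size (isolate e (multivariate_tutte M genvar)) <= 2)%N.
Proof.
rewrite /isolate map_tutte /multivariate_tutte horner_sum.
apply: leq_trans (size_sum _ _ _) _; apply/bigmax_leqP => A _.
rewrite hornerM hornerC hornerXn -rmorphXn /=.
rewrite mulrC mul_polyC; apply: leq_trans (size_scale_leq _ _) _.
have prodC (P : pred E) : (forall x, P x -> x != e) ->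
    \prod_(x | P x) isolate_coef e (genvar x) =
    (\prod_(x | P x) (genvar x)%:P)%:P.
  move=> Pe; rewrite rmorph_prod; apply: eq_bigr => x /Pe /negPf xe.
  by rewrite isolate_coef_genvar xe.
have [eA|eA] := boolP (e \in A); last first.
  rewrite prodC; last by move=> x xA; apply: contraNneq eA => <-.
  by rewrite (leq_trans (size_polyC_leq1 _)).
rewrite (bigD1 e) //= isolate_coef_genvar eqxx prodC; last by move=> x /andP[].
by rewrite mulrC mul_polyC (leq_trans (size_scale_leq _ _)) ?size_polyX.
Qed.

End Variables.

(** * Factorisations over the polynomial ring *)

Lemma linear_product_split (D : idomainType) (p q : {poly D}) :
    p != 0 -> q != 0 -> (size (p * q)%R <= 2)%N ->
  (size p <= 1)%N || (size q <= 1)%N.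
Proof.
move=> pN0 qN0; rewrite size_mul //; move: pN0 qN0; rewrite -!size_poly_gt0.
case: (size p) (size q) => [|a] [|b] // _ _; clear; lia.
Qed.

(** The two sides are q times Z(C :&: S) Z(C :\: S) and q times Z(C) Z(set0),
    for a circuit C cut by S into parts of a and b elements.  Their difference
    is q - 1 times a power of q. *)
Lemma crossing_circuit_absurd (K : fieldType) (r a b : nat) :
    (a <= r)%N -> (b <= r)%N -> (a + b <= r.+1)%N ->
  'X * ('X^(r - a) * (1 + 'X) ^+ a * ('X^(r - b) * (1 + 'X) ^+ b)) <>
  'X^(r.+1 - (a + b)) * ((1 + 'X) ^+ (a + b) + 'X - 1) * 'X^r :> {poly K}.
Proof.
move=> le_ar le_br le_abr E.
have /eqP[] := monic_neq0 (monicXsubC (1 : K)).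
have XN0 : 'X^((r.+1 - (a + b)) + r) != 0 :> {poly K}.
  by rewrite monic_neq0 ?monicXn.
apply: (mulfI XN0); rewrite mulr0.
transitivity ('X^(r.+1 - (a + b)) * ((1 + 'X) ^+ (a + b) + 'X - 1) * 'X^r -
   'X^((r.+1 - (a + b)) + r) * (1 + 'X) ^+ (a + b) : {poly K}).
  rewrite exprD; ring.
rewrite -E.
have -> : (r.+1 - (a + b) + r = (r - a) + (r - b) + 1)%N by lia.
rewrite !exprD; ring.
Qed.

Section Specialisation.
Variables (K : fieldType) (E : finType).
Local Notation R := {mpoly K[#|E|]}.
Implicit Types (f g : {poly R}) (h : E -> K).

Lemma spec_monic h f : f \is monic -> spec h f \is monic.
Proof. exact: monic_map. Qed.

Lemma isolate_neq0 e f : f \is monic -> isolate e f != 0.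
Proof.
move=> f_monic; apply/eqP => f0.
have /monic_neq0/eqP[] := spec_monic (fun _ => 0) f_monic.
by rewrite -(@spec_isolate _ _ e (fun _ => 0)) // f0 rmorph0 horner0.
Qed.

Lemma isolate_split e f g (M : matroid E) :
    f \is monic -> g \is monic -> f * g = multivariate_tutte M (@genvar K E) ->
  (size (isolate e f) <= 1)%N || (size (isolate e g) <= 1)%N.
Proof.
move=> f_monic g_monic fgZ; have := size_isolate_tutte K e M.
rewrite -fgZ isolateM; apply: linear_product_split; exact: isolate_neq0.
Qed.

(** Change the values of h into those of h' one variable at a time. *)
Lemma spec_free_eq f (B : {set E}) h h' :
    (forall e, e \in B -> (size (isolate e f) <= 1)%N) ->
    (forall e, e \notin B -> h e = h' e) -> spec h f = spec h' f.
Proof.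
move=> freeB; have [n] := ubnP #|[set x | h x != h' x]|.
elim: n h => // n IHn h; rewrite ltnS => le_n hh'.
have [/existsP[e he]|/existsPn same] := boolP [exists e, h e != h' e];
  last first.
  by apply: eq_map_poly => p; apply: meval_eq => i; apply/eqP/negPn/same.
have eB : e \in B by apply: contraNT he => /hh' ->.
pose h1 x := if x == e then h' x else h x.
have hh1 x : x != e -> h x = h1 x by rewrite /h1 => /negPf ->.
have -> : spec h f = spec h1 f.
  have /size1_polyC fc := freeB e eB.
  rewrite -(spec_isolate f hh1) -(@spec_isolate _ _ e h h) //.
  by rewrite fc !map_polyC !hornerC.
apply: IHn.
  apply: leq_trans le_n; apply: proper_card; apply/properP; split.
    by apply/subsetP => x; rewrite !inE /h1; case: ifP; rewrite ?eqxx.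
  by exists e; rewrite !inE // /h1 !eqxx.
move=> x xB; rewrite /h1; case: eqP => // _; exact: hh'.
Qed.

(** All specialisations of a factor without variables coincide, so the common
    value divides both q^r, the value of Z at the empty set, and (1 + q)^r, the
    value at a basis. *)
Lemma free_factor_trivial (M : matroid E) f g :
    f \is monic -> f * g = multivariate_tutte M (@genvar K E) ->
    (forall e, (size (isolate e f) <= 1)%N) -> size f = 1%N.
Proof.
move=> f_monic fgZ free_f.
have spec_const h : spec h f = spec (fun _ => 0) f.
  by apply: (spec_free_eq (B := [set: E])) => // e; rewrite inE.
have dvdI I : indep M I -> spec (fun _ => 0) f %|
    'X^(mrank M [set: E] - #|I|) * (1 + 'X) ^+ #|I|.
  move=> iI; rewrite -(tutte_indep K iI) -spec_tutte -fgZ rmorphM /=.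
  by rewrite spec_const dvdp_mulr.
have [I iI cardI] := mrank_base M [set: E].
have := dvdI I iI; rewrite cardI subnn mul1r => dvd_base.
have := dvdI set0 (indep_set0 M); rewrite cards0 subn0 mulr1 => dvd_Xn.
have /eqP <- : size (spec (fun _ => 0) f) == 1%N.
  rewrite -coprimepp; apply: coprimep_dvdl dvd_base _.
  rewrite coprimep_sym; apply: coprimep_dvdl dvd_Xn _.
  rewrite coprimep_expl // coprimep_expr // coprimepX.
  by rewrite rootE !hornerE oner_eq0.
by rewrite size_map_poly_id0 // (monicP f_monic) rmorph1 oner_neq0.
Qed.

(** Connectedness enters here: a circuit with elements on both sides of a
    genuine splitting of the variables contradicts [crossing_circuit_absurd]. *)
Lemma tutte_factor_trivial (M : matroid E) f g :
    mconnected M -> f \is monic -> g \is monic ->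
    f * g = multivariate_tutte M (@genvar K E) ->
  size f = 1%N \/ size g = 1%N.
Proof.
move=> conn f_monic g_monic fgZ.
have [S freeS freeC] : exists2 S : {set E},
    forall e, e \in S -> (size (isolate e f) <= 1)%N &
    forall e, e \in ~: S -> (size (isolate e g) <= 1)%N.
  exists [set e | (size (isolate e f) <= 1)%N] => e; rewrite ?in_setC in_set //.
  move=> /negP fe.
  by case/orP: (isolate_split e f_monic g_monic fgZ) => [/fe []|ge]; exact: ge.
have [S0|[e eS]] := set_0Vmem S.
  right; apply: (@free_factor_trivial M g f); rewrite 1?mulrC // => e.
  by apply: freeC; rewrite S0 setC0 inE.
have [C0|[e' e'C]] := set_0Vmem (~: S).
  left; apply: (@free_factor_trivial M f g) => // x; apply: freeS.
  by rewrite -(setCK S) C0 setC0 inE.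
have [|C [cC eC e'C']] := conn e e'.
  by apply: contraTneq e'C => <-; rewrite inE eS.
pose h A : E -> K := indicator K A.
have Zprod A : spec (h A) f * spec (h A) g = multivariate_tutte M (h A).
  by rewrite -spec_tutte -fgZ rmorphM.
have key :
    multivariate_tutte M (h (C :&: S)) * multivariate_tutte M (h (C :&: ~: S)) =
    multivariate_tutte M (h C) * multivariate_tutte M (h set0).
  rewrite -!Zprod.
  have -> : spec (h (C :&: S)) f = spec (h set0) f.
    apply: (spec_free_eq freeS) => x /negPf xS.
    by rewrite /h /indicator !inE xS andbF.
  have -> : spec (h (C :&: S)) g = spec (h C) g.
    apply: (spec_free_eq freeC) => x; rewrite inE negbK => xS.
    by rewrite /h /indicator !inE xS andbT.
  have -> : spec (h (C :&: ~: S)) g = spec (h set0) g.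
    apply: (spec_free_eq freeC) => x; rewrite !inE => /negPf xS.
    by rewrite /h /indicator !inE xS andbF.
  have -> : spec (h (C :&: ~: S)) f = spec (h C) f.
    apply: (spec_free_eq freeS) => x xS.
    by rewrite /h /indicator !inE xS andbT.
  ring.
have iS : indep M (C :&: S).
  apply: circuit_proper_indep cC _; apply/properP; split; first exact: subsetIl.
  by exists e' => //; move: e'C; rewrite !inE e'C' => /negPf ->.
have iC : indep M (C :&: ~: S).
  apply: circuit_proper_indep cC _; apply/properP; split; first exact: subsetIl.
  by exists e => //; rewrite !inE eC eS.
have /(congr1 (fun p => 'X * p)) := key.
rewrite [in RHS]mulrA (tutte_circuit K cC).
rewrite !tutte_indep ?indep_set0 // cards0 subn0 expr0 mulr1.
have cardC : (#|C :&: S| + #|C :&: ~: S| = #|C|)%N by rewrite -setDE cardsID.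
have rkC_le : (mrank M C <= mrank M [set: E])%N.
  have [I iI <-] := mrank_base M C; exact: card_indep_le (subsetT _) iI.
have := crossing_circuit_absurd (K := K) (card_indep_le (subsetT _) iS)
  (card_indep_le (subsetT _) iC).
by rewrite cardC -(mrank_circuit cC) ltnS => /(_ rkC_le).
Qed.

End Specialisation.

Theorem lemma3 (K : fieldType) (E : finType) (M : matroid E)
    (Mconn : mconnected M) (Mrank : (0 < mrank M [set: E])%N) :
  irreducible_poly (multivariate_tutte M (@ratvar K E)).
Proof.
have loopless e : indep M [set e] by exact: connected_loopless.
have [Z_monic sz_Z] := tutte_monic (@genvar K E) loopless Mrank.
have -> : multivariate_tutte M (@ratvar K E) =
    map_poly (@tofrac _) (multivariate_tutte M (@genvar K E)).
  by rewrite map_tutte.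
apply: irreducible_over_fraction => //.
- exact: mpoly_completely_integrally_closed.
- by rewrite sz_Z ltnS.
- move=> f g; exact: tutte_factor_trivial.
Qed.
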